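(* Let $\Omega=(x_0,x_N)$ be split into $N\ge 2$ non-overlapping subdomains $\Omega_i=(x_{i-1},x_i)$, $x_0<x_1<\dots<x_N$, let $d_i=x_i-x_{i-1}$ and $d_{\min}=\min_{1\le i\le N}d_i$, and let $c>0$ be the wave speed. Let $k\ge 1$ be an integer and let $T>0$ be the time window length. If $$\frac{T}{k}\le \frac{d_{\min}}{c},$$ then the Dirichlet-Neumann waveform relaxation (DNWR) algorithm (written for the error, as defined in the context) with relaxation parameter $\theta=1/2$ converges in at most $k+1$ iterations; that is, the error iterates of iteration $k+1$ satisfy $e_i^{k+1}=0$ on $\Omega_i\times(0,T)$ for all $1\le i\le N$.
   Context: Let $c>0$ (wave speed), $\tau>0$ (delay), $\lambda\in\mathbb{R}$ (free parameter), $T>0$. The underlying problem is the one-dimensional wave equation with constant time delay $w_{tt}=c^2w_{xx}+\lambda w(x,t-\tau)+f(x,t)$ on $\Omega$, with $w$ and $w_t$ prescribed for $-\tau\le t\le 0$ and Dirichlet boundary conditions on $\partial\Omega$. By linearity, the algorithm is studied through the error equations, in which all data (source, history, and values on $\partial\Omega$) are zero. DNWR algorithm for the error. Put $m=\lceil N/2\rceil$ (index of the middle subdomain). Let initial guesses $h_i^0(t)$, $t\in(0,T)$, be given along the interfaces $x_i$, $1\le i\le N-1$, and set $h_0^k=h_N^k=0$ for all $k\geq 0$ (homogeneous outer Dirichlet condition). For iteration $k=1,2,\dots$, the function $e_i^k(x,t)$ on $\Omega_i$, $1\le i\le N$, satisfies $$\partial_{tt}e_i^k(x,t)-c^2\partial_{xx}e_i^k(x,t)-\lambda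 e_i^k(x,t-\tau)=0,\quad (x,t)\in\Omega_i\times(0,T),$$ $$e_i^k(x,t)=0,\quad \partial_t e_i^k(x,t)=0,\quad x\in\Omega_i,\ t\in[-\tau,0],$$ together with the following boundary conditions for $t\in(0,T)$, the subproblems being solved starting from the middle subdomain and moving outwards. (1) Middle subdomain $\Omega_m$ (Dirichlet-Dirichlet): $e_m^k(x_{m-1},t)=h_{m-1}^{k-1}(t)$ and $e_m^k(x_m,t)=h_m^{k-1}(t)$. (2) For $i=m-1,m-2,\dots,1$ (Dirichlet on the left, Neumann on the right): $e_i^k(x_{i-1},t)=h_{i-1}^{k-1}(t)$ and $\partial_xe_i^k(x_i,t)=\partial_xe_{i+1}^k(x_i,t)$. (3) For $j=m+1,m+2,\dots,N$ (Neumann on the left, Dirichlet on the right): $\partial_xe_j^k(x_{j-1},t)=\partial_xe_{j-1}^k(x_{j-1},t)$ and $e_j^k(x_j,t)=h_j^{k-1}(t)$. The interface values are then updated, with relaxation parameter $\theta\in(0,1]$, by $$h_i^k(t)=\theta e_i^k(x_i,t)+(1-\theta)h_i^{k-1}(t),\quad 1\le i<m,$$ $$h_j^k(t)=\theta e_{j+1}^k(x_j,t)+(1-\theta)h_j^{k-1}(t),\quad m\le j\le N-1.$$ Convergence of the algorithm in a given number of iterations means that the errors $e_i^k$ vanish in all subdomains over the whole time window $(0,T)$ at that iteration. *)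

(* Defs.v *)
(* Stdlib reals with Coquelicot *)
From Stdlib Require Import Reals List.
From Coquelicot Require Import Coquelicot.
Open Scope R_scope.

(* Derivative relative to a set [D]: two-sided at interior points of [D],
   one-sided at the endpoints when [D] is an interval. *)
Definition is_derive_on (D : R -> Prop) (f : R -> R) (x l : R) : Prop :=
  filterlim (fun y => (f y - f x) / (y - x)) (within D (locally' x)) (locally l).

(* [u] is of class C^1 on the product of the intervals [I] and [J], up to
   those endpoints that belong to [I] or [J]. *)
Definition C1_on (I J : R -> Prop) (u : R -> R -> R) : Prop :=
  exists ux ut : R * R -> R,
    continuous_on (fun p => I (fst p) /\ J (snd p)) ux /\
    continuous_on (fun p => I (fst p) /\ J (snd p)) ut /\
    forall x t, I x -> J t ->
      is_derive_on I (fun y => u y t) x (ux (x, t)) /\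
      is_derive_on J (fun s => u x s) t (ut (x, t)).

(* Classical solution [u x t] on (a,b) x (0,T) of the delay wave equation
   u_tt = c^2 u_xx + lam * u(x, t - tau) with zero history. The C^1 regularity
   on [a,b] x [-tau,T) gives a meaning to the traces of u and u_x at a and b.
   [C2_inside] makes the derivatives in [wave] genuine ones (in Coquelicot,
   [Derive] is total). *)
Record delay_wave_solution (c lam tau T a b : R) (u : R -> R -> R) : Prop := {
  C1_closed : C1_on (fun x => a <= x <= b) (fun t => - tau <= t < T) u;
  C2_inside : forall x t, a < x < b -> 0 < t < T -> ex_diff_n u 2 x t;
  wave : forall x t, a < x < b -> 0 < t < T ->
    Derive_n (fun s => u x s) 2 t - c ^ 2 * Derive_n (fun y => u y t) 2 x
      - lam * u x (t - tau) = 0;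
  history : forall x t, a < x < b -> - tau <= t <= 0 ->
    u x t = 0 /\ is_derive_on (fun s => - tau <= s < T) (fun s => u x s) t 0
}.

(* Subdomain number i (1 <= i <= N) is the interval (x (i-1), x i). *)
Definition len (x : nat -> R) (i : nat) : R := x i - x (i - 1)%nat.

Definition d_min (N : nat) (x : nat -> R) : R :=
  fold_right Rmin (len x 1) (map (len x) (List.seq 1 N)).

(* ceil(N/2) *)
Definition middle (N : nat) : nat := ((N + 1) / 2)%nat.

(* The one-sided x-derivatives at the interface [x i], taken from subdomain i
   (on the left) and from subdomain i+1 (on the right), exist and coincide.
   [v i] is the iterate on subdomain i. *)
Definition same_flux (x : nat -> R) (v : nat -> R -> R -> R) (i : nat) (t : R)
  : Prop :=
  exists l,
    is_derive_on (fun y => x (i - 1)%nat <= y <= x i)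
      (fun y => v i y t) (x i) l /\
    is_derive_on (fun y => x i <= y <= x (i + 1)%nat)
      (fun y => v (i + 1)%nat y t) (x i) l.

(* [e k i] is the error on subdomain i at iteration k (k >= 1, 1 <= i <= N) and
   [h k i] the interface error at [x i] after iteration k (0 <= i <= N), [h 0]
   being the initial guess. The values of [e] and [h] at other indices are
   irrelevant. *)
Record DNWR_errors (c lam tau T theta : R) (N : nat) (x : nat -> R)
    (h : nat -> nat -> R -> R) (e : nat -> nat -> R -> R -> R) : Prop := {
  outer : forall k t, 0 < t < T -> h k 0%nat t = 0 /\ h k N t = 0;
  subproblem : forall k i, (1 <= k)%nat -> (1 <= i <= N)%nat ->
    delay_wave_solution c lam tau T (x (i - 1)%nat) (x i) (e k i);
  middle_DD : forall k t, (1 <= k)%nat -> 0 < t < T ->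
    let m := middle N in
    e k m (x (m - 1)%nat) t = h (k - 1)%nat (m - 1)%nat t /\
    e k m (x m) t = h (k - 1)%nat m t;
  left_DN : forall k i t, (1 <= k)%nat -> (1 <= i < middle N)%nat -> 0 < t < T ->
    e k i (x (i - 1)%nat) t = h (k - 1)%nat (i - 1)%nat t /\
    same_flux x (e k) i t;
  right_ND : forall k j t, (1 <= k)%nat -> (middle N + 1 <= j <= N)%nat ->
    0 < t < T ->
    same_flux x (e k) (j - 1)%nat t /\
    e k j (x j) t = h (k - 1)%nat j t;
  update_left : forall k i t, (1 <= k)%nat -> (1 <= i < middle N)%nat ->
    0 < t < T ->
    h k i t = theta * e k i (x i) t + (1 - theta) * h (k - 1)%nat i t;
  update_right : forall k j t, (1 <= k)%nat -> (middle N <= j <= N - 1)%nat ->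
    0 < t < T ->
    h k j t = theta * e k (j + 1)%nat (x j) t + (1 - theta) * h (k - 1)%nat j t
}.

(* Main.v *)
(** Reflecting [e_i] at an interface [x_i] and adding [e_(i+1)] gives a solution
    of the delay wave equation on a half-neighbourhood of [x_i] of width [d_min],
    with zero Neumann datum at [x_i] because the two fluxes agree. If all
    interface errors of the previous iteration vanish up to time [S], then so do
    all subdomain errors, and by finite propagation speed this solution vanishes
    at [x_i] up to time [S + d_min / c]: the traces of [e_i] and [e_(i+1)] at
    [x_i] are opposite up to then. One of them is the previous interface error,
    so averaging with [theta = 1/2] annihilates the new one. Thus every iteration
    extends the time of vanishing by [d_min / c].

    Finite propagation and uniqueness come from the Riemann invariants
    [u_t + c u_x] and [u_t - c u_x], which are constant along characteristics
    wherever the delayed term vanishes. *)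
Require Import Defs.
From Stdlib Require Import Reals List Lra Lia.
From Coquelicot Require Import Coquelicot.
Open Scope R_scope.

(** * Derivatives relative to a set *)

Definition limit_point (D : R -> Prop) (x : R) : Prop :=
  forall d, 0 < d -> exists y, D y /\ y <> x /\ Rabs (y - x) < d.

Lemma is_derive_on_eps (D : R -> Prop) (f : R -> R) (x l : R) :
  is_derive_on D f x l <->
  forall eps, 0 < eps -> exists d, 0 < d /\ forall y, D y -> y <> x ->
    Rabs (y - x) < d -> Rabs ((f y - f x) / (y - x) - l) < eps.
Proof.
  split.
  - intros H eps Heps.
    destruct (H (ball l (mkposreal eps Heps)) (locally_ball l _)) as [d Hd].
    exists d; split; [apply cond_pos|].
    intros y Hy Hyx Hlt. exact (Hd y Hlt Hyx Hy).
  - intros H P [eps HP].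
    destruct (H eps (cond_pos eps)) as [d [Hd HdP]].
    exists (mkposreal d Hd). intros y Hy Hyx HDy. apply HP. now apply HdP.
Qed.

Lemma is_derive_on_subset (D E : R -> Prop) (f : R -> R) (x l : R) :
  (forall y, E y -> D y) -> is_derive_on D f x l -> is_derive_on E f x l.
Proof.
  rewrite 2!is_derive_on_eps. intros HED H eps Heps.
  destruct (H eps Heps) as [d [Hd Hy]]. exists d; split; auto.
Qed.

Lemma is_derive_on_unique (D : R -> Prop) (f : R -> R) (x l l' : R) :
  limit_point D x -> is_derive_on D f x l -> is_derive_on D f x l' -> l = l'.
Proof.
  rewrite 2!is_derive_on_eps. intros HD Hl Hl'.
  destruct (Req_dec l l') as [|Hne]; auto. exfalso.
  assert (He : 0 < Rabs (l - l') / 2).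
  { assert (0 < Rabs (l - l')) by (apply Rabs_pos_lt; lra). lra. }
  destruct (Hl _ He) as [d [Hd H]]. destruct (Hl' _ He) as [d' [Hd' H']].
  destruct (HD (Rmin d d') (Rmin_pos _ _ Hd Hd')) as [y [HDy [Hyx Hy]]].
  pose proof (Rmin_l d d'). pose proof (Rmin_r d d').
  specialize (H y HDy Hyx ltac:(lra)). specialize (H' y HDy Hyx ltac:(lra)).
  revert H H'. set (r := (f y - f x) / (y - x)). clearbody r.
  unfold Rabs; repeat destruct Rcase_abs; lra.
Qed.

(** Along [E] all difference quotients are zero, and [x] is a limit point of [E], so uniqueness of
    the derivative relative to [E] decides. The set [E] may lie on one side of [x]. *)
Lemma is_derive_on_zero (D E : R -> Prop) (f : R -> R) (x l : R) :
  is_derive_on D f x l -> (forall y, E y -> D y) -> limit_point E x -> E x ->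
  (forall y, E y -> f y = 0) -> l = 0.
Proof.
  intros Hl HED HE HEx Hf.
  apply (is_derive_on_unique E f x); [exact HE | now apply (is_derive_on_subset D) |].
  rewrite is_derive_on_eps. intros eps Heps. exists 1; split; [lra|].
  intros y Hy Hyx _. rewrite (Hf y Hy), (Hf x HEx).
  replace ((0 - 0) / (y - x) - 0) with 0 by (field; lra). now rewrite Rabs_R0.
Qed.

(** Differentiability forces continuity at [x], and [f] is zero at points of [E] arbitrarily close
    to [x]. This carries the zero history from an open subdomain to its endpoints. *)
Lemma is_derive_on_limit_zero (D E : R -> Prop) (f : R -> R) (x l : R) :
  is_derive_on D f x l -> (forall y, E y -> D y) -> limit_point E x ->
  (forall y, E y -> y <> x -> f y = 0) -> f x = 0.
Proof.
  rewrite is_derive_on_eps. intros Hl HED HE Hf.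
  destruct (Req_dec (f x) 0) as [|Hne]; auto. exfalso.
  assert (Hpos : 0 < Rabs (f x)) by now apply Rabs_pos_lt.
  pose proof (Rabs_pos l) as Hlpos.
  destruct (Hl 1 Rlt_0_1) as [d [Hd H]].
  (* Within this radius, a difference quotient below [Rabs l + 1] in absolute value changes [f] by
     less than [Rabs (f x)], so [f y = 0] is impossible. *)
  assert (Hd' : 0 < Rabs (f x) / (Rabs l + 1)) by (apply Rdiv_lt_0_compat; lra).
  destruct (HE _ (Rmin_pos _ _ Hd Hd')) as [y [HEy [Hyx Hy]]].
  pose proof (Rmin_l d (Rabs (f x) / (Rabs l + 1))).
  pose proof (Rmin_r d (Rabs (f x) / (Rabs l + 1))).
  specialize (H y (HED y HEy) Hyx ltac:(lra)).
  rewrite (Hf y HEy Hyx) in H.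
  assert (Hq : Rabs ((0 - f x) / (y - x)) < Rabs l + 1).
  { pose proof (Rabs_triang ((0 - f x) / (y - x) - l) l) as Ht.
    replace ((0 - f x) / (y - x) - l + l) with ((0 - f x) / (y - x)) in Ht by ring.
    lra. }
  assert (Hyx' : 0 < Rabs (y - x)) by (apply Rabs_pos_lt; lra).
  assert (Hfx : Rabs (f x) = Rabs ((0 - f x) / (y - x)) * Rabs (y - x)).
  { rewrite <- Rabs_mult, <- Rabs_Ropp. f_equal. field. lra. }
  assert (Rabs (y - x) * (Rabs l + 1) < Rabs (f x)).
  { apply (Rmult_lt_reg_r (/ (Rabs l + 1))); [apply Rinv_0_lt_compat; lra|].
    replace (Rabs (y - x) * (Rabs l + 1) * / (Rabs l + 1)) with (Rabs (y - x))
      by (field; lra). unfold Rdiv in *; lra. }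
  nra.
Qed.

Lemma is_derive_on_interior (D : R -> Prop) (f : R -> R) (x l : R) :
  locally x D -> is_derive_on D f x l -> is_derive f x l.
Proof.
  rewrite is_derive_on_eps. intros [d0 HD] H. apply is_derive_Reals.
  intros eps Heps. destruct (H eps Heps) as [d [Hd Hy]].
  exists (mkposreal _ (Rmin_pos _ _ Hd (cond_pos d0))). intros r Hr Hlt; simpl in Hlt.
  pose proof (Rmin_l d d0). pose proof (Rmin_r d d0).
  assert (Hr' : Rabs (x + r - x) = Rabs r) by (f_equal; ring).
  specialize (Hy (x + r)). rewrite Hr' in Hy.
  replace (x + r - x) with r in Hy by ring.
  apply Hy; [|lra|lra].
  apply HD. change (Rabs (x + r - x) < d0). lra.
Qed.

Lemma is_derive_on_continuous (D : R -> Prop) (f : R -> R) (x l : R) :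
  is_derive_on D f x l -> filterlim f (within D (locally x)) (locally (f x)).
Proof.
  rewrite is_derive_on_eps. intros H P [eps HP].
  destruct (H 1 Rlt_0_1) as [d [Hd Hy]].
  pose proof (Rabs_pos l) as Hl.
  assert (Hd' : 0 < eps / (Rabs l + 1)) by
    (apply Rdiv_lt_0_compat; [apply cond_pos | lra]).
  exists (mkposreal _ (Rmin_pos _ _ Hd Hd')). intros y Hball HDy. apply HP.
  change (Rabs (y - x) < Rmin d (eps / (Rabs l + 1))) in Hball.
  change (Rabs (f y - f x) < eps).
  pose proof (Rmin_l d (eps / (Rabs l + 1))).
  pose proof (Rmin_r d (eps / (Rabs l + 1))).
  destruct (Req_dec y x) as [->|Hyx].
  { rewrite Rminus_diag_eq by reflexivity. rewrite Rabs_R0. apply cond_pos. }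
  specialize (Hy y HDy Hyx ltac:(lra)).
  assert (Hq : Rabs ((f y - f x) / (y - x)) < Rabs l + 1).
  { pose proof (Rabs_triang ((f y - f x) / (y - x) - l) l) as Ht.
    replace ((f y - f x) / (y - x) - l + l) with ((f y - f x) / (y - x)) in Ht by ring.
    lra. }
  assert (Hyx' : 0 < Rabs (y - x)) by (apply Rabs_pos_lt; lra).
  assert (Hf : Rabs (f y - f x) = Rabs ((f y - f x) / (y - x)) * Rabs (y - x)).
  { rewrite <- Rabs_mult. f_equal. field. lra. }
  assert (Rabs (y - x) * (Rabs l + 1) < eps).
  { apply (Rmult_lt_reg_r (/ (Rabs l + 1))); [apply Rinv_0_lt_compat; lra|].
    replace (Rabs (y - x) * (Rabs l + 1) * / (Rabs l + 1)) with (Rabs (y - x))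
      by (field; lra). unfold Rdiv in *; lra. }
  nra.
Qed.

Lemma is_derive_on_plus (D : R -> Prop) (f g : R -> R) (x l l' : R) :
  is_derive_on D f x l -> is_derive_on D g x l' ->
  is_derive_on D (fun y => f y + g y) x (l + l').
Proof.
  rewrite !is_derive_on_eps. intros Hf Hg eps Heps.
  destruct (Hf (eps / 2) ltac:(lra)) as [d [Hd H]].
  destruct (Hg (eps / 2) ltac:(lra)) as [d' [Hd' H']].
  exists (Rmin d d'); split; [now apply Rmin_pos|]. intros y HDy Hyx Hy.
  pose proof (Rmin_l d d'). pose proof (Rmin_r d d').
  specialize (H y HDy Hyx ltac:(lra)). specialize (H' y HDy Hyx ltac:(lra)).
  replace ((f y + g y - (f x + g x)) / (y - x) - (l + l')) with
    (((f y - f x) / (y - x) - l) + ((g y - g x) / (y - x) - l')) by (field; lra).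
  eapply Rle_lt_trans; [apply Rabs_triang | lra].
Qed.

Lemma limit_point_Ioo (a b x : R) :
  a < b -> a <= x <= b -> limit_point (fun y => a < y < b) x.
Proof.
  intros Hab Hx d Hd.
  destruct (Rlt_dec x b) as [Hxb|Hxb].
  - exists (x + Rmin d (b - x) / 2).
    assert (0 < Rmin d (b - x)) by (apply Rmin_pos; lra).
    pose proof (Rmin_l d (b - x)). pose proof (Rmin_r d (b - x)).
    repeat split; try lra.
    rewrite Rabs_pos_eq; lra.
  - exists (x - Rmin d (x - a) / 2).
    assert (0 < Rmin d (x - a)) by (apply Rmin_pos; lra).
    pose proof (Rmin_l d (x - a)). pose proof (Rmin_r d (x - a)).
    repeat split; try lra.
    rewrite Rabs_left; lra.
Qed.

Lemma limit_point_Icc (a b x : R) :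
  a < b -> a <= x <= b -> limit_point (fun y => a <= y <= b) x.
Proof.
  intros Hab Hx d Hd. destruct (limit_point_Ioo a b x Hab Hx d Hd) as [y Hy].
  exists y. intuition lra.
Qed.

Lemma locally_Ioo (a b x : R) : a < x < b -> locally x (fun y => a < y < b).
Proof.
  intros Hx. apply (locally_open (fun y => a < y < b)); [|auto|auto].
  apply open_and; [apply open_gt | apply open_lt].
Qed.

(** * Transport along characteristics *)

(** Only relative continuity is asked at the endpoints, because a characteristic may end on the
    boundary of the space-time domain. *)
Lemma constant_of_zero_derivative (f : R -> R) (a b : R) :
  a <= b -> continuous_on (fun x => a <= x <= b) f ->
  (forall x, a < x < b -> is_derive f x 0) -> f b = f a.
Proof.
  intros Hab Hc Hd.
  (* The mean value theorem wants two-sided continuity at the endpoints, so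
     [f] is extended by constants. *)
  set (clamp := fun x => Rmax a (Rmin b x)).
  assert (Hin : forall x, a <= clamp x <= b).
  { intros x. unfold clamp. split; [apply Rmax_l|].
    apply Rmax_lub; [lra | apply Rmin_l]. }
  assert (Hid : forall x, a <= x <= b -> clamp x = x).
  { intros x Hx. unfold clamp. rewrite Rmin_right, Rmax_right; lra. }
  assert (Hclip : forall x y, Rabs (clamp y - clamp x) <= Rabs (y - x)).
  { intros x y. unfold clamp, Rmax, Rmin.
    repeat destruct Rle_dec; unfold Rabs; repeat destruct Rcase_abs; lra. }
  destruct (MVT_gen (fun x => f (clamp x)) a b (fun _ => 0)) as [z [_ Hz]].
  - rewrite Rmin_left, Rmax_right by lra. intros x Hx.
    apply (is_derive_ext_loc f); [|now apply Hd].
    generalize (locally_Ioo a b x Hx). apply filter_imp. intros y Hy.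
    rewrite Hid; lra.
  - intros x _. apply continuity_pt_filterlim. intros P HP.
    destruct (Hc (clamp x) (Hin x) P HP) as [d Hdl].
    exists d. intros y Hy. apply Hdl; [|apply Hin].
    change (Rabs (clamp y - clamp x) < d).
    eapply Rle_lt_trans; [apply Hclip | exact Hy].
  - rewrite !Hid in Hz; lra.
Qed.
(* [p_t - sigma p_x = F], integrated backwards in time. Only continuity along
   characteristics is kept, so that sums and reflections are immediate. *)
Definition transported (sigma a b T : R) (p F : R -> R -> R) : Prop :=
  forall x t,
    continuous_on (fun r => a <= x + sigma * r <= b /\ 0 <= t - r < T)
      (fun r => p (x + sigma * r) (t - r)) /\
    forall r, a < x + sigma * r < b -> 0 < t - r < T ->
      is_derive (fun r => p (x + sigma * r) (t - r)) r (- F (x + sigma * r) (t - r)).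

Lemma transported_constant (sigma a b T x t r : R) (p F : R -> R -> R) :
  transported sigma a b T p F -> 0 <= r ->
  (forall s, 0 <= s <= r -> a <= x + sigma * s <= b /\ 0 <= t - s < T) ->
  (forall s, 0 < s < r -> a < x + sigma * s < b /\ 0 < t - s /\
    F (x + sigma * s) (t - s) = 0) ->
  p x t = p (x + sigma * r) (t - r).
Proof.
  intros Hp Hr Hclosed Hopen. destruct (Hp x t) as [Hc Hd].
  rewrite (constant_of_zero_derivative (fun s => p (x + sigma * s) (t - s)) 0 r Hr).
  - f_equal; ring.
  - apply (continuous_on_subset _ _ _ Hclosed Hc).
  - intros s Hs. destruct (Hopen s Hs) as [Hx [Ht HF]].
    destruct (Hclosed s ltac:(lra)) as [_ HT].
    generalize (Hd s Hx ltac:(lra)). now rewrite HF, Ropp_0.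
Qed.

(** The substitution [x0 + s * y] with [s = 1] or [s = -1] maps characteristics to characteristics;
    a reflection reverses their direction, whence the speed [s * sigma]. *)
Lemma transported_affine (sigma s x0 a b a' b' T : R) (p F : R -> R -> R) :
  transported sigma a b T p F -> s * s = 1 ->
  (forall y, a' <= y <= b' -> a <= x0 + s * y <= b) ->
  transported (s * sigma) a' b' T
    (fun y => p (x0 + s * y)) (fun y => F (x0 + s * y)).
Proof.
  intros Hp Hs Hab x t. destruct (Hp (x0 + s * x) t) as [Hc Hd].
  assert (Heq : forall r, x0 + s * (x + s * sigma * r) = x0 + s * x + sigma * r).
  { intros r. transitivity (x0 + s * x + s * s * (sigma * r)); [ring|].
    rewrite Hs; ring. }
  split.
  - apply continuous_on_ext with
      (f := fun r => p (x0 + s * x + sigma * r) (t - r)).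
    { intros r _. now rewrite Heq. }
    apply (continuous_on_subset _ _ _) with (2 := Hc).
    intros r [Hx Ht]. rewrite <- Heq. auto.
  - intros r Hx Ht.
    apply is_derive_ext with (fun r => p (x0 + s * x + sigma * r) (t - r)).
    { intros r'. now rewrite Heq. }
    rewrite Heq. apply Hd; [|exact Ht]. rewrite <- Heq.
    assert (Ha := Hab a' ltac:(lra)). assert (Hb := Hab b' ltac:(lra)).
    assert (Hs' : s = 1 \/ s = -1).
    { assert (Hf : (s - 1) * (s + 1) = 0) by lra.
      apply Rmult_integral in Hf. lra. }
    destruct Hs'; subst s; lra.
Qed.

Lemma transported_plus (sigma a b T : R) (p q F G : R -> R -> R) :
  transported sigma a b T p F -> transported sigma a b T q G ->
  transported sigma a b T (fun x t => p x t + q x t) (fun x t => F x t + G x t).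
Proof.
  intros Hp Hq x t. destruct (Hp x t) as [Hpc Hpd]. destruct (Hq x t) as [Hqc Hqd].
  split.
  - intros r Hr. eapply filterlim_comp_2; [exact (Hpc r Hr) | exact (Hqc r Hr) |].
    apply (filterlim_plus (p (x + sigma * r) (t - r)) (q (x + sigma * r) (t - r))).
  - intros r Hx Ht. rewrite Ropp_plus_distr.
    apply (is_derive_plus (fun r => p (x + sigma * r) (t - r))
      (fun r => q (x + sigma * r) (t - r))); auto.
Qed.

(* [p] and [q] are the Riemann invariants [u_t + c u_x] and [u_t - c u_x]:
   going backwards in time, [p] travels to the right and [q] to the left. *)
Record characteristic_form (c lam tau T a b : R) (u p q : R -> R -> R) : Prop := {
  invariant_p : transported c a b T p (fun x t => lam * u x (t - tau));
  invariant_q : transported (- c) a b T q (fun x t => lam * u x (t - tau));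
  time_derivative : forall x t, a <= x <= b -> 0 <= t < T ->
    is_derive_on (fun s => - tau <= s < T) (u x) t ((p x t + q x t) / 2)
}.

Lemma characteristic_form_plus (c lam tau T a b : R) (u p q v p' q' : R -> R -> R) :
  characteristic_form c lam tau T a b u p q ->
  characteristic_form c lam tau T a b v p' q' ->
  characteristic_form c lam tau T a b (fun x t => u x t + v x t)
    (fun x t => p x t + p' x t) (fun x t => q x t + q' x t).
Proof.
  (* The sources [lam * u + lam * v] and [lam * (u + v)] agree pointwise, so [transported] is first
     shown to respect pointwise equality of sources. *)
  assert (Hext : forall sigma (f F G : R -> R -> R), (forall x t, F x t = G x t) ->
    transported sigma a b T f F -> transported sigma a b T f G).
  { intros sigma f F G HFG Hf x t. destruct (Hf x t) as [Hc Hd]. split; [exact Hc|].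
    intros r. rewrite <- HFG. apply Hd. }
  intros [Hp Hq Ht] [Hp' Hq' Ht']. split.
  - eapply Hext; [|exact (transported_plus _ _ _ _ _ _ _ _ Hp Hp')].
    intros; simpl; ring.
  - eapply Hext; [|exact (transported_plus _ _ _ _ _ _ _ _ Hq Hq')].
    intros; simpl; ring.
  - intros x t Hx HtT.
    replace ((p x t + p' x t + (q x t + q' x t)) / 2)
      with ((p x t + q x t) / 2 + (p' x t + q' x t) / 2) by field.
    apply is_derive_on_plus; auto.
Qed.

Lemma characteristic_form_translate (c lam tau T a b a' b' x0 : R)
  (u p q : R -> R -> R) :
  characteristic_form c lam tau T a b u p q -> a <= x0 + a' -> x0 + b' <= b ->
  characteristic_form c lam tau T a' b' (fun y => u (x0 + 1 * y))
    (fun y => p (x0 + 1 * y)) (fun y => q (x0 + 1 * y)).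
Proof.
  intros [Hp Hq Ht] Ha Hb. split.
  - replace c with (1 * c) by ring.
    apply (transported_affine c 1 x0 a b _ _ _ p _ Hp); intros; lra.
  - replace (- c) with (1 * - c) by ring.
    apply (transported_affine (- c) 1 x0 a b _ _ _ q _ Hq); intros; lra.
  - intros y t Hy HtT. apply Ht; lra.
Qed.

(** Reflection changes the sign of the [x]-derivative, so the two invariants exchange their
    roles. *)
Lemma characteristic_form_reflect (c lam tau T a b a' b' x0 : R)
  (u p q : R -> R -> R) :
  characteristic_form c lam tau T a b u p q -> a <= x0 - b' -> x0 - a' <= b ->
  characteristic_form c lam tau T a' b' (fun y => u (x0 + -1 * y))
    (fun y => q (x0 + -1 * y)) (fun y => p (x0 + -1 * y)).
Proof.
  intros [Hp Hq Ht] Ha Hb. split.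
  - replace c with (-1 * - c) by ring.
    apply (transported_affine (- c) (-1) x0 a b _ _ _ q _ Hq); intros; lra.
  - replace (- c) with (-1 * c) by ring.
    apply (transported_affine c (-1) x0 a b _ _ _ p _ Hp); intros; lra.
  - intros y t Hy HtT.
    rewrite (Rplus_comm (q _ _)). apply Ht; lra.
Qed.

(** * Finite speed of propagation *)

(** Backward characteristics from the cone never meet [b]: those of [p] end on the base at time [S],
    those of [q] on the base or on the side [x = a]. The implication assumed at [a] covers both a
    Dirichlet and a Neumann condition. With [p = q = 0], the time derivative of [u] vanishes. *)
Lemma cone_vanishing (c lam tau T a b S S1 : R) (u p q : R -> R -> R) :
  0 < c -> 0 < tau -> 0 <= S < T ->
  characteristic_form c lam tau T a b u p q ->
  (forall x t, a <= x <= b -> - tau <= t <= S -> u x t = 0) ->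
  (forall x, a <= x <= b -> p x S = 0 /\ q x S = 0) ->
  (forall t, S < t < T -> t <= S1 -> p a t = 0 -> q a t = 0) ->
  forall x t, a <= x -> S <= t < T -> t <= S1 -> x - a + c * (t - S) <= b - a ->
    u x t = 0.
Proof.
  intros Hc Htau HS [Hp Hq Hut] Hzero Hbase Hbc.
  (* The delayed term looks back by [tau], so the cone is treated in slabs of
     height [tau] in which this term is already known to vanish. *)
  assert (Hslab : forall n x t, a <= x -> S <= t < T -> t <= S1 ->
    x - a + c * (t - S) <= b - a -> t <= S + INR n * tau -> u x t = 0).
  { induction n as [|n IH]; intros x t Hax Ht HtS1 Hcone Hn.
    { apply Hzero; simpl in Hn; nra. }
    rewrite S_INR in Hn.
    assert (HF : forall y s, a <= y -> S <= s <= t -> y - a + c * (s - S) <= b - a ->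
      lam * u y (s - tau) = 0).
    { intros y s Hy Hs Hys.
      enough (u y (s - tau) = 0) as -> by ring.
      (* Either the delayed time is at most [S], where [u] is zero, or the delayed point lies in the
         cone one slab lower: decreasing the time keeps a point in the cone. *)
      destruct (Rle_dec (s - tau) S).
      - apply Hzero; nra.
      - apply IH; try lra; nra. }
    (* Position plus [c] times time is constant on these characteristics, so they stay in the cone
       down to time [S]. *)
    assert (Hp0 : forall y s, a <= y -> S <= s <= t ->
      y - a + c * (s - S) <= b - a -> p y s = 0).
    { intros y s Hy Hs Hys.
      rewrite (transported_constant c a b T y s (s - S) p _ Hp) by
        first [ lra | intros s' Hs'; repeat split; try apply HF; nra ].
      replace (s - (s - S)) with S by ring. apply Hbase; nra. }
    assert (Hq0 : forall y s, a <= y -> S <= s <= t ->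
      y - a + c * (s - S) <= b - a -> q y s = 0).
    { intros y s Hy Hs Hys.
      (* The characteristic of [q] moves left: it reaches time [S] first, or it hits [x = a] after
         the time [r = (y - a) / c], where [p = 0] gives [q = 0]. *)
      destruct (Rle_dec (c * (s - S)) (y - a)) as [Hin|Hout].
      - rewrite (transported_constant (- c) a b T y s (s - S) q _ Hq) by
          first [ lra | intros s' Hs'; repeat split; try apply HF; nra ].
        replace (s - (s - S)) with S by ring. apply Hbase; nra.
      - set (r := (y - a) / c).
        assert (Hr : c * r = y - a) by (unfold r; field; lra).
        assert (0 <= r) by (apply Rdiv_le_0_compat; lra).
        assert (r < s - S) by (apply (Rmult_lt_reg_l c); lra).
        rewrite (transported_constant (- c) a b T y s r q _ Hq) by
          first [ lra | intros s' Hs'; repeat split; try apply HF; nra ].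
        replace (y + - c * r) with a by lra.
        apply Hbc; [lra | lra |]. apply Hp0; [lra | lra | nra]. }
    rewrite (constant_of_zero_derivative (u x) S t).
    - apply Hzero; nra.
    - lra.
    - intros s Hs.
      eapply filterlim_filter_le_1;
        [|exact (is_derive_on_continuous _ _ _ _ (Hut x s ltac:(nra) ltac:(lra)))].
      intros P. unfold within. apply filter_imp. intros s' HP Hs'. apply HP; lra.
    - intros s Hs. replace 0 with ((p x s + q x s) / 2).
      + apply (is_derive_on_interior (fun s => - tau <= s < T)).
        * generalize (locally_Ioo (- tau) T s ltac:(lra)). apply filter_imp; intros; lra.
        * apply Hut; nra.
      + rewrite Hp0, Hq0; [lra | lra | lra | nra | lra | lra | nra]. }
  intros x t Hax Ht HtS1 Hcone.
  destruct (INR_unbounded ((t - S) / tau)) as [n Hn].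
  apply (Hslab n); auto.
  apply (Rmult_lt_compat_r tau) in Hn; [|exact Htau].
  replace ((t - S) / tau * tau) with (t - S) in Hn by (field; lra). lra.
Qed.

(** * Riemann invariants of classical solutions *)

(** Partial derivatives, one of them continuous at the point, give total differentiability, as
    needed for the chain rule along a characteristic. *)
Lemma ex_diff_1_differentiable (f : R -> R -> R) (x y : R) :
  locally_2d (ex_diff_n f 1) x y ->
  differentiable_pt_lim f x y (Derive (fun z => f z y) x) (Derive (fun z => f x z) y).
Proof.
  intros H. pose proof (locally_2d_singleton _ _ _ H) as [_ [Hx [Hy [[Hcx _] _]]]].
  apply filterdiff_differentiable_pt_lim.
  apply (is_derive_filterdiff f x y (fun u v => Derive (fun z => f z v) u)).
  - apply locally_2d_locally in H. revert H. apply filter_imp.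
    intros [u v] [_ [Hu _]]. now apply Derive_correct.
  - now apply Derive_correct.
  - intros P [eps HP]. apply continuity_2d_pt_filterlim in Hcx.
    apply Hcx. now exists eps.
Qed.

(** The chain rule produces the two mixed second derivatives with opposite signs, and they cancel by
    the Schwarz theorem. For [sigma ^ 2 = c ^ 2] the wave operator remains. *)
Lemma characteristic_derivative (sigma x t r : R) (u : R -> R -> R) :
  locally_2d (ex_diff_n u 2) (x + sigma * r) (t - r) ->
  is_derive (fun s => Derive (fun z => u (x + sigma * s) z) (t - s)
      + sigma * Derive (fun y => u y (t - s)) (x + sigma * s)) r
    (sigma ^ 2 * Derive_n (fun y => u y (t - r)) 2 (x + sigma * r)
      - Derive_n (fun s => u (x + sigma * r) s) 2 (t - r)).
Proof.
  intros H.
  assert (Hux := ex_diff_1_differentiable (fun y s => Derive (fun z => u z s) y)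
    (x + sigma * r) (t - r)).
  assert (Hut := ex_diff_1_differentiable (fun y s => Derive (fun z => u y z) s)
    (x + sigma * r) (t - r)).
  assert (H1 : locally_2d (ex_diff_n (fun y s => Derive (fun z => u z s) y) 1)
      (x + sigma * r) (t - r)
    /\ locally_2d (ex_diff_n (fun y s => Derive (fun z => u y z) s) 1)
      (x + sigma * r) (t - r)).
  { split; revert H; apply locally_2d_impl, locally_2d_forall; intros y s;
      intros [_ [_ [_ [Hx Ht]]]]; assumption. }
  destruct H1 as [H1x H1t]. specialize (Hux H1x). specialize (Hut H1t).
  assert (Hmixed := Schwarz u (x + sigma * r) (t - r)).
  assert (Hx : derivable_pt_lim (fun s => x + sigma * s) r sigma).
  { apply is_derive_Reals. auto_derive; auto. ring. }
  assert (Ht : derivable_pt_lim (fun s => t - s) r (-1)).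
  { apply is_derive_Reals. auto_derive; auto. }
  assert (Dx := derivable_pt_lim_comp_2d _ _ _ _ _ _ _ _ Hux Hx Ht).
  assert (Dt := derivable_pt_lim_comp_2d _ _ _ _ _ _ _ _ Hut Hx Ht).
  apply is_derive_Reals in Dx. apply is_derive_Reals in Dt.
  assert (D := is_derive_plus _ _ _ _ _ Dt (is_derive_scal _ _ sigma _ Dx)).
  eapply is_derive_ext_loc; [|eapply (eq_ind _ (fun l => is_derive _ r l) D)].
  - apply filter_forall. intros s. reflexivity.
  - simpl. unfold plus; simpl. rewrite Hmixed; [ring | | |].
    + revert H; apply locally_2d_impl, locally_2d_forall; intros y s.
      intros [_ [Hy [Hs [Hxx Htt]]]]. repeat split; try assumption.
      * now destruct Htt as [_ [Htx _]].
      * now destruct Hxx as [_ [_ [Hxt _]]].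
    + now destruct (locally_2d_singleton _ _ _ H1t) as [_ [_ [_ [[Hc _] _]]]].
    + now destruct (locally_2d_singleton _ _ _ H1x) as [_ [_ [_ [_ [Hc _]]]]].
Qed.

(** The first derivatives are carried as functions [ux] and [ut] because at endpoints they are
    one-sided, whereas [Derive] is two-sided. *)
Record wave_traces (c lam tau T a b : R) (u : R -> R -> R) (ux ut : R * R -> R)
  : Prop := {
  trace_x : forall x t, a <= x <= b -> - tau <= t < T ->
    is_derive_on (fun y => a <= y <= b) (fun y => u y t) x (ux (x, t));
  trace_t : forall x t, a <= x <= b -> - tau <= t < T ->
    is_derive_on (fun s => - tau <= s < T) (fun s => u x s) t (ut (x, t));
  invariants : characteristic_form c lam tau T a b u
    (fun x t => ut (x, t) + c * ux (x, t)) (fun x t => ut (x, t) + - c * ux (x, t))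
}.

Lemma solution_traces (c lam tau T a b : R) (u : R -> R -> R) :
  0 < tau -> delay_wave_solution c lam tau T a b u ->
  exists ux ut, wave_traces c lam tau T a b u ux ut.
Proof.
  intros Htau [[ux [ut [Hcx [Hct Hd]]]] HC2 Hwave _]. exists ux, ut.
  (* Both invariants are treated at once, with [sigma = c] and [sigma = - c]. *)
  assert (Htr : forall sigma, sigma ^ 2 = c ^ 2 -> transported sigma a b T
    (fun x t => ut (x, t) + sigma * ux (x, t)) (fun x t => lam * u x (t - tau))).
  { intros sigma Hsigma x t. split.
    - assert (Hcomp : forall f : R * R -> R,
        continuous_on (fun p => a <= fst p <= b /\ - tau <= snd p < T) f ->
        continuous_on (fun r => a <= x + sigma * r <= b /\ 0 <= t - r < T)
          (fun r => f (x + sigma * r, t - r))).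
      { intros f Hf r Hr P HP.
        specialize (Hf (x + sigma * r, t - r) ltac:(simpl; lra) P HP).
        assert (Hline : continuous (fun r => (x + sigma * r, t - r)) r).
        { apply (continuous_comp_2 (fun r => x + sigma * r) (fun r => t - r) pair).
          - apply (ex_derive_continuous (fun r => x + sigma * r)). auto_derive; auto.
          - apply (ex_derive_continuous (fun r => t - r)). auto_derive; auto.
          - apply continuous_ext with (fun z : R * R => z); [now intros []|].
            apply continuous_id. }
        specialize (Hline _ Hf). revert Hline. unfold filtermap, within. apply filter_imp.
        intros s Hs Hdom. apply Hs. simpl. lra. }
      intros r Hr.
      eapply filterlim_comp_2; [exact (Hcomp ut Hct r Hr) | |].
      + eapply filterlim_comp; [exact (Hcomp ux Hcx r Hr)|].
        apply (filterlim_scal_r sigma (ux (x + sigma * r, t - r))).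
      + apply (filterlim_plus (ut (x + sigma * r, t - r))
          (sigma * ux (x + sigma * r, t - r))).
    - intros r Hx Ht.
      assert (Hwv := Hwave _ _ Hx Ht).
      replace (- (lam * u (x + sigma * r) (t - r - tau))) with
        (sigma ^ 2 * Derive_n (fun y => u y (t - r)) 2 (x + sigma * r)
          - Derive_n (fun s => u (x + sigma * r) s) 2 (t - r))
        by (rewrite Hsigma; lra).
      (* At interior points the relative derivatives are ordinary ones, so [ux] and [ut] may be
         replaced by [Derive] near any interior point of a characteristic. *)
      assert (Hint : forall y s, a < y < b -> 0 < s < T ->
        Derive (fun z => u y z) s = ut (y, s) /\ Derive (fun z => u z s) y = ux (y, s)).
      { intros y s Hy Hs. destruct (Hd y s ltac:(lra) ltac:(lra)) as [Hdx Hdt].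
        split; apply is_derive_unique.
        - apply (is_derive_on_interior (fun s => - tau <= s < T)); [|exact Hdt].
          generalize (locally_Ioo (- tau) T s ltac:(lra)).
          apply filter_imp; intros; lra.
        - apply (is_derive_on_interior (fun y => a <= y <= b)); [|exact Hdx].
          generalize (locally_Ioo a b y Hy). apply filter_imp; intros; lra. }
      eapply is_derive_ext_loc; [|apply characteristic_derivative].
      + assert (Hl : continuous (fun r => x + sigma * r) r).
        { apply (ex_derive_continuous (fun r => x + sigma * r)). auto_derive; auto. }
        assert (Hl' : continuous (fun r => t - r) r).
        { apply (ex_derive_continuous (fun r => t - r)). auto_derive; auto. }
        assert (Hs : locally r (fun r => a < x + sigma * r < b))
          by exact (Hl _ (locally_Ioo a b _ Hx)).
        assert (Hs' : locally r (fun r => 0 < t - r < T))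
          by exact (Hl' _ (locally_Ioo 0 T _ Ht)).
        generalize (filter_and _ _ Hs Hs'). apply filter_imp.
        clear Hs Hs'. intros s [Hs Hs']. simpl.
        destruct (Hint _ _ Hs Hs') as [-> ->]. reflexivity.
      + apply locally_2d_locally.
        assert (Hz : locally (x + sigma * r, t - r) (fun z => a < fst z < b))
          by exact (continuous_fst _ _ _ (locally_Ioo a b _ Hx)).
        assert (Hz' : locally (x + sigma * r, t - r) (fun z => 0 < snd z < T))
          by exact (continuous_snd _ _ _ (locally_Ioo 0 T _ Ht)).
        generalize (filter_and _ _ Hz Hz'). apply filter_imp.
        clear Hz Hz'. intros z [Hz Hz']. now apply HC2. }
  split.
  - intros x t Hx Ht. now apply Hd.
  - intros x t Hx Ht. now apply Hd.
  - split.
    + apply Htr. reflexivity.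
    + apply Htr. ring.
    + intros x t Hx Ht. replace (_ / 2) with (ut (x, t)) by field.
      apply Hd; lra.
Qed.

(** * Vanishing on one subdomain and across an interface *)

Lemma closed_history (c lam tau T a b : R) (u : R -> R -> R) :
  0 < T -> a < b -> delay_wave_solution c lam tau T a b u ->
  forall x t, a <= x <= b -> - tau <= t <= 0 -> u x t = 0.
Proof.
  intros HT Hab [[ux [ut [_ [_ Hd]]]] _ _ Hh] x t Hx Ht.
  apply (is_derive_on_limit_zero (fun y => a <= y <= b) (fun y => a < y < b)
    (fun y => u y t) x (ux (x, t))).
  - apply Hd; lra.
  - intros; lra.
  - now apply limit_point_Ioo.
  - intros y Hy _. now apply Hh.
Qed.

Section Traces.

Variables (c lam tau T a b : R) (u : R -> R -> R) (ux ut : R * R -> R).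
Hypotheses (Hc : 0 < c) (Htau : 0 < tau) (Hab : a < b).
Hypothesis W : wave_traces c lam tau T a b u ux ut.

Lemma trace_x_zero (x t : R) : a <= x <= b -> - tau <= t < T ->
  (forall y, a <= y <= b -> u y t = 0) -> ux (x, t) = 0.
Proof.
  intros Hx Ht Hu.
  apply (is_derive_on_zero (fun y => a <= y <= b) (fun y => a <= y <= b)
    (fun y => u y t) x); auto.
  - now apply W.
  - now apply limit_point_Icc.
Qed.

(** Left difference quotients determine the derivative, and [- tau < t] guarantees that there are
    some. *)
Lemma trace_t_zero (x t : R) : a <= x <= b -> - tau < t < T ->
  (forall s, - tau <= s <= t -> u x s = 0) -> ut (x, t) = 0.
Proof.
  intros Hx Ht Hu.
  apply (is_derive_on_zero (fun s => - tau <= s < T) (fun s => - tau <= s <= t)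
    (u x) t); auto.
  - apply W; lra.
  - intros; lra.
  - apply limit_point_Icc; lra.
  - lra.
Qed.

(** Each half of the interval lies in a cone based at its own endpoint; the right half is handled by
    reflection about [b]. *)
Lemma vanishing_step (S S1 : R) :
  0 <= S < T ->
  (forall x t, a <= x <= b -> - tau <= t <= S -> u x t = 0) ->
  (forall t, 0 < t < T -> t <= S1 -> ut (a, t) = 0 \/ ux (a, t) = 0) ->
  (forall t, 0 < t < T -> t <= S1 -> ut (b, t) = 0 \/ ux (b, t) = 0) ->
  forall x t, a <= x <= b -> S <= t < T -> t <= S1 -> c * (t - S) <= (b - a) / 2 ->
    u x t = 0.
Proof.
  intros HS Hu Ha Hb x t Hx Ht HtS1 Hct.
  assert (H0 : forall y, a <= y <= b -> ux (y, S) = 0 /\ ut (y, S) = 0).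
  { intros y Hy. split.
    - apply trace_x_zero; [lra | lra |]. intros; apply Hu; lra.
    - apply trace_t_zero; [lra | lra |]. intros; apply Hu; lra. }
  destruct (Rle_dec (x - a) ((b - a) / 2)) as [Hl|Hr].
  - refine (cone_vanishing c lam tau T a b S S1 u _ _ Hc Htau HS
      (invariants _ _ _ _ _ _ _ _ _ W) Hu _ _ x t _ _ _ _); try lra.
    + intros y Hy. destruct (H0 y Hy) as [-> ->]. split; ring.
    (* Zero [ut] means [q = - p] and zero [ux] means [q = p]; in both cases [p = 0] forces
       [q = 0]. *)
    + intros s Hs HsS1 Hp. destruct (Ha s ltac:(lra) HsS1) as [H|H]; rewrite H in *; lra.
  - assert (Hrefl := characteristic_form_reflect _ _ _ _ a b 0 (b - a) b _ _ _
      (invariants _ _ _ _ _ _ _ _ _ W) ltac:(lra) ltac:(lra)).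
    replace x with (b + -1 * (b - x)) by ring.
    refine (cone_vanishing c lam tau T 0 (b - a) S S1 _ _ _ Hc Htau HS
      Hrefl _ _ _ (b - x) t _ _ _ _); try lra.
    + intros y s Hy Hs. apply Hu; lra.
    + intros y Hy. destruct (H0 (b + -1 * y) ltac:(lra)) as [-> ->]. split; ring.
    + replace (b + -1 * 0) with b by ring.
      intros s Hs HsS1 Hp. destruct (Hb s ltac:(lra) HsS1) as [H|H]; rewrite H in *; lra.
Qed.

Lemma vanishing_of_boundary (S1 : R) :
  (forall x t, a <= x <= b -> - tau <= t <= 0 -> u x t = 0) ->
  (forall t, 0 < t < T -> t <= S1 -> ut (a, t) = 0 \/ ux (a, t) = 0) ->
  (forall t, 0 < t < T -> t <= S1 -> ut (b, t) = 0 \/ ux (b, t) = 0) ->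
  forall x t, a <= x <= b -> - tau <= t < T -> t <= S1 -> u x t = 0.
Proof.
  intros Hu Ha Hb.
  (* The time a wave takes to cross half the interval, that is, the gain of one [vanishing_step]. *)
  set (d := (b - a) / 2 / c).
  assert (Hcd : c * d = (b - a) / 2) by (unfold d; field; lra).
  assert (Hd : 0 < d) by (apply Rdiv_lt_0_compat; lra).
  assert (Hn : forall n x t, a <= x <= b -> - tau <= t < T -> t <= S1 ->
    t <= INR n * d -> u x t = 0).
  { induction n as [|n IH]; intros x t Hx Ht HtS1 Hn.
    { simpl in Hn. apply Hu; lra. }
    destruct (Rle_dec t (INR n * d)) as [Hle|Hgt]; [now apply IH|].
    rewrite S_INR in Hn. pose proof (pos_INR n).
    apply (vanishing_step (INR n * d) S1); auto; try nra.
    intros y s Hy Hs. apply IH; lra. }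
  intros x t Hx Ht HtS1.
  destruct (INR_unbounded (t / d)) as [n Hnd].
  apply (Hn n); auto.
  apply (Rmult_lt_compat_r d) in Hnd; [|exact Hd].
  replace (t / d * d) with t in Hnd by (field; lra). lra.
Qed.

End Traces.

(* With equal fluxes at the interface [b], the sum of [u] reflected at [b] and
   of [w] is a solution on a half-neighbourhood of [b] with homogeneous Neumann
   condition at [b]. *)
Lemma opposite_traces (c lam tau T a b b' d S : R) (u w : R -> R -> R)
  (ux ut wx wt : R * R -> R) :
  0 < c -> 0 < tau -> a < b < b' -> d <= b - a -> d <= b' - b -> 0 <= S < T ->
  wave_traces c lam tau T a b u ux ut -> wave_traces c lam tau T b b' w wx wt ->
  (forall x t, a <= x <= b -> - tau <= t <= S -> u x t = 0) ->
  (forall x t, b <= x <= b' -> - tau <= t <= S -> w x t = 0) ->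
  (forall t, 0 < t < T -> ux (b, t) = wx (b, t)) ->
  forall t, S <= t < T -> c * (t - S) <= d -> u b t + w b t = 0.
Proof.
  intros Hc Htau Hb Hd Hd' HS Wu Ww Hu Hw Hflux t Ht Hct.
  assert (Hsum := characteristic_form_plus _ _ _ _ _ _ _ _ _ _ _ _
    (characteristic_form_reflect _ _ _ _ a b 0 d b _ _ _
      (invariants _ _ _ _ _ _ _ _ _ Wu) ltac:(lra) ltac:(lra))
    (characteristic_form_translate _ _ _ _ b b' 0 d b _ _ _
      (invariants _ _ _ _ _ _ _ _ _ Ww) ltac:(lra) ltac:(lra))).
  replace (u b t + w b t) with (u (b + -1 * 0) t + w (b + 1 * 0) t)
    by (f_equal; f_equal; ring).
  refine (cone_vanishing c lam tau T 0 d S t _ _ _ Hc Htau HS Hsum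
    _ _ _ 0 t _ _ _ _); try lra.
  - intros y s Hy Hs. rewrite Hu, Hw by lra. ring.
  - intros y Hy.
    rewrite (trace_x_zero c lam tau T a b u ux ut), (trace_t_zero c lam tau T a b u ux ut),
      (trace_x_zero c lam tau T b b' w wx wt), (trace_t_zero c lam tau T b b' w wx wt);
      try assumption; try lra; try (split; ring);
      intros; first [apply Hu; lra | apply Hw; lra].
  (* For the sum, [p - q = 2 c (wx - ux)] at the interface, which is zero by equality of the
     fluxes. *)
  - replace (b + -1 * 0) with b by ring. replace (b + 1 * 0) with b by ring.
    intros s Hs _ Hp. rewrite (Hflux s ltac:(lra)) in *. lra.
Qed.

(** * The DNWR iteration *)

Lemma d_min_le (N : nat) (x : nat -> R) (i : nat) :
  (1 <= i <= N)%nat -> d_min N x <= x i - x (i - 1)%nat.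
Proof.
  intros Hi. unfold d_min.
  assert (Hin : In (len x i) (map (len x) (List.seq 1 N))).
  { apply in_map, in_seq. lia. }
  change (x i - x (i - 1)%nat) with (len x i).
  induction (map (len x) (List.seq 1 N)) as [|y l IH]; [easy|]. simpl.
  destruct Hin as [->|Hin]; [apply Rmin_l|].
  eapply Rle_trans; [apply Rmin_r | now apply IH].
Qed.

Lemma middle_bounds (N : nat) : (2 <= N)%nat -> (1 <= middle N <= N - 1)%nat.
Proof.
  intros HN. unfold middle.
  pose proof (Nat.div_mod_eq (N + 1) 2). pose proof (Nat.mod_upper_bound (N + 1) 2).
  lia.
Qed.

(** Turns a zero Dirichlet datum into the condition on [ut] used by [vanishing_of_boundary]; the
    history supplies the times up to zero. *)
Lemma dirichlet_trace (c lam tau T a b S z : R) (u : R -> R -> R) (ux ut : R * R -> R) :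
  0 < T -> 0 < tau -> a < b -> delay_wave_solution c lam tau T a b u ->
  wave_traces c lam tau T a b u ux ut -> a <= z <= b ->
  (forall t, 0 < t < T -> t <= S -> u z t = 0) ->
  forall t, 0 < t < T -> t <= S -> ut (z, t) = 0.
Proof.
  intros HT Htau Hab Hsol W Hz Hu t Ht HtS.
  apply (trace_t_zero c lam tau T a b u ux ut); auto; [lra|].
  intros s Hs. destruct (Rle_dec s 0).
  - apply (closed_history c lam tau T a b u); auto; lra.
  - apply Hu; lra.
Qed.

Lemma same_flux_traces (c lam tau T t : R) (x : nat -> R) (v : nat -> R -> R -> R)
  (i : nat) (ux ut wx wt : R * R -> R) :
  0 < tau -> x (i - 1)%nat < x i < x (i + 1)%nat -> 0 < t < T ->
  wave_traces c lam tau T (x (i - 1)%nat) (x i) (v i) ux ut ->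
  wave_traces c lam tau T (x i) (x (i + 1)%nat) (v (i + 1)%nat) wx wt ->
  same_flux x v i t -> ux (x i, t) = wx (x i, t).
Proof.
  intros Htau Hx Ht Wu Ww [l [Hu Hw]]. transitivity l.
  - apply (is_derive_on_unique _ _ _ _ _) with (2 := trace_x _ _ _ _ _ _ _ _ _ Wu
      (x i) t ltac:(lra) ltac:(lra)) (3 := Hu).
    apply limit_point_Icc; lra.
  - apply (is_derive_on_unique _ _ _ _ _) with (2 := Hw) (3 := trace_x _ _ _ _ _ _ _ _ _ Ww
      (x i) t ltac:(lra) ltac:(lra)).
    apply limit_point_Icc; lra.
Qed.

Section Iteration.

Variables (c lam tau T : R) (N : nat) (x : nat -> R).
Variables (h : nat -> nat -> R -> R) (e : nat -> nat -> R -> R -> R).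
Hypotheses (Hc : 0 < c) (Htau : 0 < tau) (HT : 0 < T) (HN : (2 <= N)%nat).
Hypothesis Hx : forall i : nat, (i < N)%nat -> x i < x (i + 1)%nat.
Hypothesis HE : DNWR_errors c lam tau T (1 / 2) N x h e.

Lemma node_increasing (i : nat) : (1 <= i <= N)%nat -> x (i - 1)%nat < x i.
Proof.
  intros Hi. replace i with (i - 1 + 1)%nat at 2 by lia. apply Hx. lia.
Qed.

(** The flux is matched by the subdomain farther from the middle: number [i] on the left side,
    number [i + 1] on the right side. *)
Lemma interface_flux (k i : nat) (t : R) :
  (1 <= k)%nat -> (1 <= i <= N - 1)%nat -> 0 < t < T -> same_flux x (e k) i t.
Proof.
  intros Hk Hi Ht. destruct (Nat.lt_ge_cases i (middle N)) as [Hl|Hr].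
  - apply (left_DN _ _ _ _ _ _ _ _ _ HE); auto; lia.
  - replace i with (i + 1 - 1)%nat by lia.
    apply (right_ND _ _ _ _ _ _ _ _ _ HE); auto; lia.
Qed.

Lemma next_subproblem (k i : nat) :
  (1 <= k)%nat -> (i <= N - 1)%nat ->
  delay_wave_solution c lam tau T (x i) (x (i + 1)%nat) (e k (i + 1)%nat).
Proof.
  intros Hk Hi. replace i with (i + 1 - 1)%nat at 1 by lia.
  apply (subproblem _ _ _ _ _ _ _ _ _ HE); lia.
Qed.

(** Follows the order of solution: the middle subdomain has two zero Dirichlet data, and each
    further one has a zero Dirichlet datum at its outer end and a zero flux inherited from its
    solved neighbour. *)
Lemma errors_vanish (k : nat) (S : R) :
  (1 <= k)%nat ->
  (forall i t, (i <= N)%nat -> 0 < t < T -> t <= S -> h (k - 1)%nat i t = 0) ->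
  forall i y t, (1 <= i <= N)%nat -> x (i - 1)%nat <= y <= x i ->
    - tau <= t < T -> t <= S -> e k i y t = 0.
Proof.
  intros Hk Hh. pose proof (middle_bounds N HN) as Hm.
  set (m := middle N) in *.
  assert (Hsub : forall i, (1 <= i <= N)%nat ->
    delay_wave_solution c lam tau T (x (i - 1)%nat) (x i) (e k i)).
  { intros i Hi. now apply (subproblem _ _ _ _ _ _ _ _ _ HE). }
  assert (Hmid : forall y t, x (m - 1)%nat <= y <= x m -> - tau <= t < T ->
    t <= S -> e k m y t = 0).
  { pose proof (node_increasing m ltac:(lia)) as Hlt.
    pose proof (Hsub m ltac:(lia)) as Hsol.
    destruct (solution_traces c lam tau T _ _ _ Htau Hsol) as [ux [ut W]].
    apply (vanishing_of_boundary c lam tau T _ _ _ ux ut Hc Htau Hlt W S).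
    - now apply (closed_history c lam tau T).
    - intros t Ht HtS. left.
      apply (dirichlet_trace _ _ _ _ _ _ S _ _ _ _ HT Htau Hlt Hsol W); auto; [lra|].
      intros s Hs HsS.
      destruct (middle_DD _ _ _ _ _ _ _ _ _ HE k s Hk Hs) as [H _].
      fold m in H. rewrite H.
      apply Hh; auto; lia.
    - intros t Ht HtS. left.
      apply (dirichlet_trace _ _ _ _ _ _ S _ _ _ _ HT Htau Hlt Hsol W); auto; [lra|].
      intros s Hs HsS.
      destruct (middle_DD _ _ _ _ _ _ _ _ _ HE k s Hk Hs) as [_ H].
      fold m in H. rewrite H.
      apply Hh; auto; lia. }
  (* Here [j] is the distance to the middle subdomain. *)
  assert (Hleft : forall j, (j < m)%nat -> forall y t,
    x (m - j - 1)%nat <= y <= x (m - j)%nat -> - tau <= t < T -> t <= S ->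
    e k (m - j)%nat y t = 0).
  { induction j as [|j IH]; intros Hj; [now rewrite Nat.sub_0_r|].
    specialize (IH ltac:(lia)).
    set (i := (m - Datatypes.S j)%nat) in *. replace (m - j)%nat with (i + 1)%nat in IH by lia.
    replace (i + 1 - 1)%nat with i in IH by lia.
    pose proof (node_increasing i ltac:(lia)) as Hlt.
    pose proof (Hx i ltac:(lia)) as Hlt'.
    pose proof (Hsub i ltac:(lia)) as Hsol.
    pose proof (next_subproblem k i Hk ltac:(lia)) as Hsol'.
    destruct (solution_traces c lam tau T _ _ _ Htau Hsol) as [ux [ut W]].
    destruct (solution_traces c lam tau T _ _ _ Htau Hsol') as [wx [wt W']].
    apply (vanishing_of_boundary c lam tau T _ _ _ ux ut Hc Htau Hlt W S).
    - now apply (closed_history c lam tau T).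
    - intros t Ht HtS. left.
      apply (dirichlet_trace _ _ _ _ _ _ S _ _ _ _ HT Htau Hlt Hsol W); auto; [lra|].
      intros s Hs HsS.
      rewrite (proj1 (left_DN _ _ _ _ _ _ _ _ _ HE k i s Hk ltac:(lia) Hs)).
      apply Hh; auto; lia.
    - intros t Ht HtS. right.
      rewrite (same_flux_traces c lam tau T t x (e k) i ux ut wx wt); auto.
      + apply (trace_x_zero c lam tau T _ _ _ wx wt Hlt' W'); try lra.
        intros y Hy. apply IH; lra.
      + apply interface_flux; auto; lia. }
  assert (Hright : forall j, (m + j <= N)%nat -> forall y t,
    x (m + j - 1)%nat <= y <= x (m + j)%nat -> - tau <= t < T -> t <= S ->
    e k (m + j)%nat y t = 0).
  { induction j as [|j IH]; intros Hj; [now rewrite Nat.add_0_r|].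
    specialize (IH ltac:(lia)). replace (m + Datatypes.S j)%nat with (m + j + 1)%nat in * by lia.
    set (i := (m + j)%nat) in *. replace (i + 1 - 1)%nat with i by lia.
    pose proof (node_increasing i ltac:(lia)) as Hlt.
    pose proof (Hx i ltac:(lia)) as Hlt'.
    pose proof (Hsub i ltac:(lia)) as Hsol.
    pose proof (next_subproblem k i Hk ltac:(lia)) as Hsol'.
    destruct (solution_traces c lam tau T _ _ _ Htau Hsol) as [ux [ut W]].
    destruct (solution_traces c lam tau T _ _ _ Htau Hsol') as [wx [wt W']].
    apply (vanishing_of_boundary c lam tau T _ _ _ wx wt Hc Htau Hlt' W' S).
    - now apply (closed_history c lam tau T).
    - intros t Ht HtS. right.
      rewrite <- (same_flux_traces c lam tau T t x (e k) i ux ut wx wt); auto.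
      + apply (trace_x_zero c lam tau T _ _ _ ux ut Hlt W); try lra.
        intros y Hy. apply IH; lra.
      + apply interface_flux; auto; lia.
    - intros t Ht HtS. left.
      apply (dirichlet_trace _ _ _ _ _ _ S _ _ _ _ HT Htau Hlt' Hsol' W'); auto; [lra|].
      intros s Hs HsS.
      rewrite (proj2 (right_ND _ _ _ _ _ _ _ _ _ HE k (i + 1)%nat s Hk ltac:(lia) Hs)).
      apply Hh; auto; lia. }
  intros i y t Hi. destruct (Nat.le_gt_cases i m).
  - replace i with (m - (m - i))%nat by lia. apply Hleft. lia.
  - replace i with (m + (i - m))%nat by lia. apply Hright. lia.
Qed.

(** Each iteration gains [d / c], the time a wave needs to cross a length [d] that fits into every
    subdomain. *)
Lemma interface_errors_vanish (d : R) :
  0 <= d -> (forall i, (1 <= i <= N)%nat -> d <= x i - x (i - 1)%nat) ->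
  forall k i t, (i <= N)%nat -> 0 < t < T -> t <= INR k * (d / c) -> h k i t = 0.
Proof.
  intros Hd0 Hd. pose proof (middle_bounds N HN) as Hm.
  (* For [k = 0] the time range is empty, so the initial guess is arbitrary. *)
  induction k as [|k IH]; intros i t Hi Ht Htk; [simpl in Htk; lra|].
  set (S := INR k * (d / c)) in *.
  rewrite S_INR in Htk.
  assert (HcS : c * (t - S) <= d).
  { apply Rle_trans with (c * (d / c)); [|right; field; lra].
    apply Rmult_le_compat_l; unfold S; lra. }
  assert (HS : 0 <= S).
  { apply Rmult_le_pos; [apply pos_INR | apply Rdiv_le_0_compat; lra]. }
  assert (He : forall j y s, (1 <= j <= N)%nat -> x (j - 1)%nat <= y <= x j ->
    - tau <= s < T -> s <= S -> e (Datatypes.S k) j y s = 0).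
  { apply errors_vanish; [lia|]. replace (Datatypes.S k - 1)%nat with k by lia.
    exact IH. }
  assert (Hopp : (1 <= i <= N - 1)%nat ->
    e (Datatypes.S k) i (x i) t + e (Datatypes.S k) (i + 1)%nat (x i) t = 0).
  { intros Hi'.
    pose proof (node_increasing i ltac:(lia)) as Hlt.
    pose proof (Hx i ltac:(lia)) as Hlt'.
    assert (He' : forall y s, x i <= y <= x (i + 1)%nat ->
      - tau <= s <= S -> s < T -> e (Datatypes.S k) (i + 1)%nat y s = 0).
    { intros y s Hy Hs HsT. apply He; [lia | | lra | lra].
      now replace (i + 1 - 1)%nat with i by lia. }
    destruct (Rle_dec t S) as [HtS|HtS].
    { rewrite He, He' by first [lia | lra]. ring. }
    assert (Hsol : delay_wave_solution c lam tau T (x (i - 1)%nat) (x i)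
      (e (Datatypes.S k) i)) by (apply (subproblem _ _ _ _ _ _ _ _ _ HE); lia).
    assert (Hsol' := next_subproblem (Datatypes.S k) i ltac:(lia) ltac:(lia)).
    destruct (solution_traces c lam tau T _ _ _ Htau Hsol) as [ux [ut W]].
    destruct (solution_traces c lam tau T _ _ _ Htau Hsol') as [wx [wt W']].
    apply (opposite_traces c lam tau T (x (i - 1)%nat) (x i) (x (i + 1)%nat) d S
      _ _ ux ut wx wt); auto; try lra.
    - apply Hd; lia.
    - pose proof (Hd (i + 1)%nat ltac:(lia)) as Hd'.
      now replace (i + 1 - 1)%nat with i in Hd' by lia.
    - intros y s Hy Hs. apply He; [lia | lra | lra | lra].
    - intros y s Hy Hs. apply He'; lra.
    - intros s Hs. apply (same_flux_traces c lam tau T s x (e (Datatypes.S k)) i ux ut wx wt);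
        auto.
      apply interface_flux; auto; lia. }
  destruct (outer _ _ _ _ _ _ _ _ _ HE (Datatypes.S k) t Ht) as [H0 HhN].
  destruct (Nat.eq_dec i 0) as [->|Hi0]; [exact H0|].
  destruct (Nat.eq_dec i N) as [->|HiN]; [exact HhN|].
  specialize (Hopp ltac:(lia)).
  destruct (Nat.lt_ge_cases i (middle N)) as [Hl|Hr].
  - rewrite (update_left _ _ _ _ _ _ _ _ _ HE) by (auto; lia).
    (* The old interface error is the Dirichlet datum of subdomain [i + 1], hence the opposite of
       the trace of subdomain [i], and their mean is zero. Which condition imposes it depends on
       whether [i + 1] is the middle. *)
    enough (e (Datatypes.S k) (i + 1)%nat (x i) t = h (Datatypes.S k - 1)%nat i t) by lra.
    destruct (Nat.eq_dec (i + 1) (middle N)) as [Heq|Hne].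
    + destruct (middle_DD _ _ _ _ _ _ _ _ _ HE (Datatypes.S k) t ltac:(lia) Ht) as [H _].
      rewrite <- Heq in H. now replace (i + 1 - 1)%nat with i in H by lia.
    + destruct (left_DN _ _ _ _ _ _ _ _ _ HE (Datatypes.S k) (i + 1) t ltac:(lia)
        ltac:(lia) Ht) as [H _].
      now replace (i + 1 - 1)%nat with i in H by lia.
  - rewrite (update_right _ _ _ _ _ _ _ _ _ HE) by (auto; lia).
    (* Mirror image: the old interface error is now the Dirichlet datum of subdomain [i]. *)
    enough (e (Datatypes.S k) i (x i) t = h (Datatypes.S k - 1)%nat i t) by lra.
    destruct (Nat.eq_dec i (middle N)) as [->|Hne].
    + now apply (middle_DD _ _ _ _ _ _ _ _ _ HE (Datatypes.S k) t ltac:(lia) Ht).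
    + now apply (right_ND _ _ _ _ _ _ _ _ _ HE (Datatypes.S k) i t ltac:(lia)
        ltac:(lia) Ht).
Qed.

End Iteration.

Theorem theorem1 (c tau lam T : R) (N : nat) (x : nat -> R) (k : nat)
  (h : nat -> nat -> R -> R) (e : nat -> nat -> R -> R -> R)
  (hc : 0 < c) (htau : 0 < tau) (hT : 0 < T) (hN : (2 <= N)%nat)
  (hx : forall i : nat, (i < N)%nat -> x i < x (i + 1)%nat)
  (hk : (1 <= k)%nat)
  (hTk : T / INR k <= d_min N x / c)
  (hDNWR : DNWR_errors c lam tau T (1 / 2) N x h e) :
  forall (i : nat) (y t : R), (1 <= i <= N)%nat ->
    x (i - 1)%nat < y < x i -> 0 < t < T ->
    e (k + 1)%nat i y t = 0.
Proof.
  intros i y t Hi Hy Ht.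
  assert (Hk : 0 < INR k) by (apply lt_0_INR; lia).
  assert (HTk : T <= INR k * (d_min N x / c)).
  { apply (Rmult_le_compat_l (INR k)) in hTk; [|lra].
    now replace (INR k * (T / INR k)) with T in hTk by (field; lra). }
  assert (Hd : 0 <= d_min N x).
  { assert (0 < T / INR k) by (apply Rdiv_lt_0_compat; lra).
    replace (d_min N x) with (d_min N x / c * c) by (field; lra). nra. }
  (* After [k] updates the interface errors vanish on all of [(0,T)]; the additional iteration
     solves every subproblem with these zero data. *)
  apply (errors_vanish c lam tau T N x h e hc htau hT hN hx hDNWR (k + 1) T);
    [lia | | exact Hi | lra | lra | lra].
  replace (k + 1 - 1)%nat with k by lia. intros j s Hj Hs _.
  apply (interface_errors_vanish c lam tau T N x h e hc htau hT hN hx hDNWR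
    (d_min N x) Hd (d_min_le N x)); [exact Hj | exact Hs | lra].
Qed.
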